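(* Let $\sqrt n\in\mathbb{N}$, let $\mathbf{A}_0\in\mathbb{C}^{n\times n}$ denote the 2D discrete Fourier matrix and consider its partition into $M=\sqrt n$ blocks $\mathbf{B}_1,\dots,\mathbf{B}_{\sqrt n}$ of rows consisting of lines in the 2D Fourier domain. Let $\varepsilon\in(0,1)$, and assume that $\mathbf{x}\in\mathbb{C}^n$ is $s$-sparse. Let $c>0$ be the universal constant appearing in the sufficient condition $$m\ \ge\ c\,s\,\max_{1\le j\le M}\frac{\|\mathbf{B}_j^*\mathbf{B}_j\|_{1\to\infty}}{\pi_j}\,\log(4n)\log(12\varepsilon^{-1})\qquad(\star)$$ for exact recovery of $\mathbf{x}$ with probability at least $1-\varepsilon$ (see context). The drawing probability $\Pi=(\pi_j)_{1\le j\le\sqrt n}$ minimizing the right-hand side of $(\star)$ is given by $$\pi_j^\star=\frac{1}{\sqrt n},\qquad\forall j\in\{1,\dots,\sqrt n\},$$ and for this particular choice, a number $m$ of blocks of measurements sufficient to reconstruct $\mathbf{x}$ with probability at least $1-\varepsilon$ (i.e. for $\mathbf{x}$ to be the unique solution of the $\ell_1$-minimization problem in the context) is $$m\ \ge\ c\,s\,\log(4n)\log(12\varepsilon^{-1}).$$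
   Context: The rows of $\mathbf{A}_0$ are indexed by $(p_1,p_2)$ and its columns by $(\ell_1,\ell_2)$, with $1\le p_1,p_2,\ell_1,\ell_2\le\sqrt n$, and its entries are $\frac{1}{\sqrt n}\exp\big(2i\pi\frac{p_1\ell_1+p_2\ell_2}{\sqrt n}\big)$. The block $\mathbf{B}_{p_1}\in\mathbb{C}^{\sqrt n\times n}$ consists of the rows $(p_1,p_2)$, $1\le p_2\le\sqrt n$ (a horizontal line of the Fourier plane). Given a probability distribution $\Pi=(\pi_1,\dots,\pi_M)$ on $\{1,\dots,M\}$ with positive weights, the sensing matrix is $$\mathbf{A}=\frac1{\sqrt m}\begin{pmatrix}\mathbf{B}_{k_1}/\sqrt{\pi_{k_1}}\\ \vdots\\ \mathbf{B}_{k_m}/\sqrt{\pi_{k_m}}\end{pmatrix},$$ where $k_1,\dots,k_m$ are i.i.d. with distribution $\Pi$. The reconstruction problem is $\min_{\mathbf{z}\in\mathbb{C}^n}\|\mathbf{z}\|_1$ subject to $\mathbf{A}\mathbf{z}=\mathbf{A}\mathbf{x}$. $\|\mathbf{M}\|_{1\to\infty}=\sup_{\|\mathbf{v}\|_1\le1}\|\mathbf{M}\mathbf{v}\|_\infty$ is the largest modulus of an entry of $\mathbf{M}$. A vector is $s$-sparse if its number of non-zero entries equals $s$. The constant $c$ is a universal constant such that, if $(\star)$ holds, then $\mathbf{x}$ is the unique solution of the reconstruction problem with probability at least $1-\varepsilon$. *)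

(* Defs.v *)
From HB Require Import structures.
From mathcomp Require Import all_boot all_order all_algebra.
From mathcomp Require Import complex.
From mathcomp Require Import all_classical all_reals all_analysis.
Set Implicit Arguments.
Unset Strict Implicit.
Unset Printing Implicit Defensive.
Import Order.TTheory GRing.Theory Num.Theory.
Import Normc.

Local Open Scope classical_set_scope.
Local Open Scope complex_scope.
Local Open Scope ring_scope.

Definition norm1 (R : realType) n (v : 'cV[R[i]]_n) : R :=
  \sum_(i < n) normc (v i ord0).

(* Moduli are nonnegative, so starting the maximum at 0 is harmless. *)
Definition norminf (R : realType) n (v : 'cV[R[i]]_n) : R :=
  \big[Num.max/0]_(i < n) normc (v i ord0).

Definition norm1inf (R : realType) m n (M : 'M[R[i]]_(m, n)) : R :=
  sup [set norminf (M *m v) | v in [set v : 'cV[R[i]]_n | norm1 v <= 1]].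

Definition adjointmx (R : realType) m n (M : 'M[R[i]]_(m, n)) : 'M[R[i]]_(n, m) :=
  map_mx Num.conj M^T.

Definition sparse (R : realType) n (s : nat) (x : 'cV[R[i]]_n) : Prop :=
  #|[set i : 'I_n | x i ord0 != 0]%SET| = s.

(* With q = sqrt n, the n = q * q rows and columns are indexed by pairs in
   'I_q * 'I_q through MathComp's mxvec_index.  Since 'I_q starts at 0, the
   frequency / position p in {1, .., q} is p.+1 for p : 'I_q. *)

Definition expi (R : realType) (t : R) : R[i] := cos t +i* sin t.

Definition idx_pair q (i : 'I_(q * q)) : 'I_q * 'I_q :=
  pair_of_mxvec_index (mxvec_indexP i).

Definition dft2 (R : realType) (q : nat) : 'M[R[i]]_(q * q) :=
  \matrix_(i, j)
    let: (p1, p2) := idx_pair i in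
    let: (l1, l2) := idx_pair j in
    ((q%:R)^-1)%:C *
    expi (2 * pi * ((p1.+1 * l1.+1 + p2.+1 * l2.+1)%N%:R / q%:R)).

Definition dft_block (R : realType) (q : nat) (p1 : 'I_q) : 'M[R[i]]_(q, q * q) :=
  rowsub (fun p2 : 'I_q => mxvec_index p1 p2) (dft2 R q).

Lemma idx_pairK q (p1 p2 : 'I_q) : idx_pair (mxvec_index p1 p2) = (p1, p2).
Proof.
have idxE (i : 'I_(q * q)) :
    mxvec_index (idx_pair i).1 (idx_pair i).2 = i.
  by rewrite /idx_pair; case: (mxvec_indexP i).
have := idxE (mxvec_index p1 p2).
by move=> /cast_ord_inj/enum_rank_inj; rewrite -surjective_pairing.
Qed.

Lemma dft2E (R : realType) q (p1 p2 l1 l2 : 'I_q) :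
  dft2 R q (mxvec_index p1 p2) (mxvec_index l1 l2) =
  ((q%:R)^-1)%:C *
  expi (2 * pi * ((p1.+1 * l1.+1 + p2.+1 * l2.+1)%N%:R / q%:R)).
Proof. by rewrite mxE !idx_pairK. Qed.

Definition block_weights (R : realType) q (w : 'I_q -> R) : Prop :=
  (forall j, 0 < w j) /\ \sum_(j < q) w j = 1.

Definition uniform_weights (R : realType) q : 'I_q -> R := fun=> (q%:R)^-1.

Definition sensing_matrix (R : realType) q m (w : 'I_q -> R) (k : 'I_m -> 'I_q)
    : 'M[R[i]]_(\sum_(i < m) q, q * q) :=
  ((Num.sqrt m%:R)^-1)%:C *:
  \mxcol_(i < m) (((Num.sqrt (w (k i)))^-1)%:C *: dft_block R (k i)).

(* 'I_q carries the discrete sigma-algebra: every subset is measurable. *)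
Definition iid_draws (R : realType) d (T : measurableType d)
    (P : probability T R) q m (w : 'I_q -> R) (k : 'I_m -> T -> 'I_q) : Prop :=
  [/\ forall (i : 'I_m) (J : set 'I_q), measurable (k i @^-1` J),
      forall (i : 'I_m) (j : 'I_q), P (k i @^-1` [set j]) = (w j)%:E
    & forall (I : {set 'I_m}) (J : 'I_m -> set 'I_q),
        P (\bigcap_(i in [set` I]) (k i @^-1` J i)) =
        (\prod_(i in I) P (k i @^-1` J i))%E].

Definition l1_solution (R : realType) m n (A : 'M[R[i]]_(m, n))
    (y : 'cV[R[i]]_m) (z : 'cV[R[i]]_n) : Prop :=
  A *m z = y /\ forall z', A *m z' = y -> norm1 z <= norm1 z'.

(* [unique p x] is [p x /\ forall x', p x' -> x = x']. *)
Definition exact_recovery (R : realType) m n (A : 'M[R[i]]_(m, n))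
    (x : 'cV[R[i]]_n) : Prop :=
  unique (l1_solution A (A *m x)) x.

Definition recovers_whp (R : realType) q (m : nat) (w : 'I_q -> R)
    (x : 'cV[R[i]]_(q * q)) (eps : R) : Prop :=
  forall (d : measure_display) (T : measurableType d) (P : probability T R)
         (k : 'I_m -> T -> 'I_q),
    iid_draws P w k ->
    ((1 - eps)%:E <=
     P [set t | exact_recovery (sensing_matrix w (fun i => k i t)) x])%E.

(* The maximum is over nonnegative numbers, and 0 < q in every use. *)
Definition sampling_bound (R : realType) (c : R) (s : nat) (eps : R) q
    (w : 'I_q -> R) : R :=
  c * s%:R *
  (\big[Num.max/0]_(j < q)
     (norm1inf (adjointmx (dft_block R j) *m dft_block R j) / w j)) *
  ln (4 * (q * q)%:R) * ln (12 * eps^-1).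

Definition recovery_constant (R : realType) (c : R) : Prop :=
  forall (q s m : nat) (eps : R) (w : 'I_q -> R) (x : 'cV[R[i]]_(q * q)),
    (0 < q)%N -> 0 < eps < 1 -> sparse s x -> block_weights w ->
    sampling_bound c s eps w <= m%:R ->
    recovers_whp m w x eps.

Definition minimizes_bound (R : realType) (c : R) (s : nat) (eps : R) q
    (w : 'I_q -> R) : Prop :=
  block_weights w /\
  forall w' : 'I_q -> R, block_weights w' ->
    sampling_bound c s eps w <= sampling_bound c s eps w'.

(* Main.v *)
Require Import Defs.
From mathcomp Require Import all_boot all_order all_algebra.
From mathcomp Require Import complex.
From mathcomp Require Import all_classical all_reals all_analysis.
Import Order.TTheory GRing.Theory Num.Theory.
Local Open Scope ring_scope.

(** All entries of a block [B_j] have modulus [1/q], so the Gram matrix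
    [B_j^* B_j] has entries of modulus at most [q * q^-2 = 1/q], attained on its
    diagonal: [norm1inf (B_j^* B_j) = 1/q] for every [j].  The bound is thus
    proportional to [max_j 1 / w_j], and weights summing to 1 satisfy
    [min_j w_j <= 1/q], with equality only if they are uniform. *)

Lemma normc_sum (R : realType) n (F : 'I_n -> complex R) :
  Normc.normc (\sum_i F i) <= \sum_i Normc.normc (F i).
Proof.
elim/big_rec2: _ => [|i y z _ le_zy]; first by rewrite Normc.normc0.
by apply: le_trans (le_normcD _ _) _; rewrite lerD2l.
Qed.

Lemma normc_ge0 (R : realType) (z : complex R) : 0 <= Normc.normc z.
Proof. by case: z => a b; exact: sqrtr_ge0. Qed.

Lemma norm1_delta (R : realType) n (j : 'I_n) :
  norm1 (delta_mx j ord0 : 'cV[complex R]_n) = 1.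
Proof.
rewrite /norm1 (bigD1 j) //= big1 => [|i neij]; last first.
  by rewrite mxE (negPf neij) Normc.normc0.
by rewrite mxE !eqxx Normc.normc1 addr0.
Qed.

(** Triangle inequality on each coordinate of [M *m v], with [a] factored out of the sum. *)
Lemma norminf_mul_le (R : realType) m n (M : 'M[complex R]_(m, n)) (a : R)
    (v : 'cV_n) :
  0 <= a -> (forall i j, Normc.normc (M i j) <= a) ->
  norminf (M *m v) <= a * norm1 v.
Proof.
move=> a_ge0 M_le; have v_ge0 : 0 <= norm1 v.
  by apply: sumr_ge0 => j _; exact: normc_ge0.
apply: bigmax_le => [|i _]; first exact: mulr_ge0.
rewrite mxE (le_trans (normc_sum _ _ _)) // mulr_sumr ler_sum // => j _.
by rewrite Normc.normcM ler_wpM2r ?normc_ge0.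
Qed.

(** The entry bound gives one inequality; the basis vector of column [j], of l1 norm 1, attains
    it. *)
Lemma norm1inf_eq (R : realType) m n (M : 'M[complex R]_(m, n)) i j :
  (forall i' j', Normc.normc (M i' j') <= Normc.normc (M i j)) ->
  norm1inf M = Normc.normc (M i j).
Proof.
move=> M_le; set a := Normc.normc _.
have a_ge0 : 0 <= a by exact: normc_ge0.
have a_ub : ubound [set norminf (M *m v) | v in
    [set v : 'cV[complex R]_n | norm1 v <= 1]]%classic a.
  move=> _ [v /= v_le <-].
  apply: le_trans (norminf_mul_le _ _ _ _ _ v a_ge0 M_le) _.
  by rewrite -[leRHS]mulr1 ler_wpM2l.
have delta_in : [set norminf (M *m v) | v in
    [set v : 'cV[complex R]_n | norm1 v <= 1]]%classic
    (norminf (M *m delta_mx j ord0)).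
  by exists (delta_mx j ord0) => //=; rewrite norm1_delta.
apply/eqP; rewrite eq_le; apply/andP; split.
  by apply: ge_sup => //; eexists; exact: delta_in.
apply: le_trans (ub_le_sup _ delta_in); last by exists a.
(* The image of the basis vector is column [j] of [M], and [M i j] is one of its entries. *)
rewrite /norminf -colE /a; have -> : M i j = col j M i ord0 by rewrite mxE.
exact: (le_bigmax _ (fun i => Normc.normc (col j M i ord0))).
Qed.

Lemma normc_real (R : realType) (a : R) : 0 <= a ->
  Normc.normc (real_complex R a) = a.
Proof. by move=> a_ge0; rewrite /= expr0n addr0 sqrtr_sqr ger0_norm. Qed.

Lemma normc_conjM (R : realType) (z : complex R) :
  Num.conj z * z = real_complex R (Normc.normc z ^+ 2).
Proof.
rewrite mulrC -sqr_normc rmorphXn; congr (_ ^+ 2); exact: normc_def.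
Qed.

Lemma normc_conj (R : realType) (z : complex R) :
  Normc.normc (Num.conj z) = Normc.normc z.
Proof. by case: z => a b /=; rewrite sqrrN. Qed.

Lemma normc_dft_block (R : realType) q (p1 : 'I_q) p2 l :
  Normc.normc (dft_block R p1 p2 l) = q%:R^-1.
Proof.
rewrite !mxE idx_pairK; case: (idx_pair l) => l1 l2.
rewrite Normc.normcM normc_real ?invr_ge0 ?ler0n // /expi.
by rewrite /Normc.normc cos2Dsin2 sqrtr1 mulr1.
Qed.

Lemma norm1inf_gram_dft_block (R : realType) q (p : 'I_q) :
  norm1inf (adjointmx (dft_block R p) *m dft_block R p) = q%:R^-1.
Proof.
have q_neq0 : q%:R != 0 :> R.
  by rewrite pnatr_eq0 -lt0n (leq_trans _ (ltn_ord p)).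
have sumq : \sum_(i < q) q%:R^-1 ^+ 2 = q%:R^-1 :> R.
  by rewrite sumr_const card_ord -[LHS]mulr_natl expr2 mulVKf.
(* Any diagonal position would do; [p] is merely an available index. *)
pose l := mxvec_index p p.
have diagE : Normc.normc ((adjointmx (dft_block R p) *m dft_block R p) l l) =
    q%:R^-1.
  (* On the diagonal each summand is [conj z * z] with [z] of modulus 1/q, so no cancellation occurs
     and the triangle inequality is an equality. *)
  rewrite mxE -[RHS]normc_real ?invr_ge0 ?ler0n // -sumq raddf_sum.
  congr Normc.normc; apply: eq_bigr => i _.
  by rewrite [X in X * _]mxE [X in Num.conj X]mxE normc_conjM normc_dft_block.
rewrite -[RHS]diagE; apply: norm1inf_eq => l1 l2; rewrite diagE mxE.
apply: le_trans (normc_sum _ _ _) _; rewrite -[leRHS]sumq ler_sum // => i _.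
by rewrite Normc.normcM 2!mxE normc_conj !normc_dft_block.
Qed.

Lemma sampling_boundE (R : realType) (c : R) s eps q (w : 'I_q -> R) :
  sampling_bound c s eps w =
  c * s%:R * (\big[Num.max/0]_(j < q) (q%:R^-1 / w j)) *
  ln (4 * (q * q)%:R) * ln (12 * eps^-1).
Proof.
rewrite /sampling_bound; do 3 congr (_ * _).
by apply: eq_bigr => j _; rewrite norm1inf_gram_dft_block.
Qed.

Lemma uniform_block_weights (R : realType) q : (0 < q)%N ->
  block_weights (@uniform_weights R q).
Proof.
move=> q_gt0; split=> [j|]; first by rewrite invr_gt0 ltr0n.
by rewrite sumr_const card_ord -[LHS]mulr_natl divff // pnatr_eq0 -lt0n.
Qed.

Lemma max_ratio_uniform (R : realType) q : (0 < q)%N ->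
  \big[Num.max/0]_(j < q) (q%:R^-1 / uniform_weights R j) = 1.
Proof.
move=> q_gt0; have ratio1 (j : 'I_q) : q%:R^-1 / uniform_weights R j = 1.
  by rewrite divff // invr_eq0 pnatr_eq0 -lt0n.
apply/eqP; rewrite eq_le bigmax_le => [|//|j _]; last by rewrite ratio1.
(* An actual index is needed here: over an empty range the maximum would be its default value 0. *)
rewrite -[leLHS](ratio1 (Ordinal q_gt0)).
exact: (le_bigmax _ (fun j => q%:R^-1 / uniform_weights R j)).
Qed.

(** Ratios at most 1 mean [w i >= 1/q]; the gaps [w i - 1/q] are then nonnegative with sum 1 - 1 =
    0, so each vanishes. *)
Lemma max_ratio_le1 (R : realType) q (w : 'I_q -> R) : block_weights w ->
  \big[Num.max/0]_(j < q) (q%:R^-1 / w j) <= 1 -> forall j, w j = q%:R^-1.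
Proof.
move=> [w_gt0 w_sum] max_le j.
have q_gt0 : (0 < q)%N by exact: leq_trans (ltn_ord j).
have w_ge i : q%:R^-1 <= w i.
  rewrite -[leRHS]mul1r -ler_pdivrMr //; apply: le_trans max_le.
  exact: (le_bigmax _ (fun j => q%:R^-1 / w j)).
have : \sum_i (w i - q%:R^-1) = 0.
  by rewrite sumrB w_sum (uniform_block_weights R _ q_gt0).2 subrr.
move/eqP; rewrite psumr_eq0 => [|i _]; last by rewrite subr_ge0.
by move/allP/(_ j (mem_index_enum _)); rewrite subr_eq0 => /eqP.
Qed.

(** A maximum below 1 would force uniform weights by [max_ratio_le1], but their maximum is exactly
    1. *)
Lemma max_ratio_ge1 (R : realType) q (w : 'I_q -> R) : (0 < q)%N ->
  block_weights w -> 1 <= \big[Num.max/0]_(j < q) (q%:R^-1 / w j).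
Proof.
move=> q_gt0 w_wt; rewrite leNgt; apply/negP => max_lt1.
have w_unif := max_ratio_le1 _ _ _ w_wt (ltW max_lt1).
have wE : w = @uniform_weights R q by apply/funext.
by move: max_lt1; rewrite wE max_ratio_uniform // ltxx.
Qed.

Theorem proposition4p6 (R : realType) (c : R) (hc : 0 < c)
    (hrec : recovery_constant c)
    (q s : nat) (hq : (0 < q)%N)
    (eps : R) (heps : 0 < eps < 1)
    (x : 'cV[complex R]_(q * q)) (hx : sparse s x) :
  [/\ minimizes_bound c s eps (@uniform_weights R q),
      (0 < s)%N ->
        forall w : 'I_q -> R, minimizes_bound c s eps w ->
          forall j : 'I_q, w j = (q%:R)^-1
    & forall m : nat,
        c * s%:R * ln (4 * (q * q)%:R) * ln (12 * eps^-1) <= m%:R ->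
        recovers_whp m (@uniform_weights R q) x eps].
Proof.
have unif_wt := uniform_block_weights R _ hq.
have ln_n_gt0 : 0 < ln (4 * (q * q)%:R) :> R.
  by apply: ln_gt0; rewrite -natrM ltr1n (@leq_trans (4 * 1)) // leq_mul2l
    muln_gt0 hq.
have ln_eps_gt0 : 0 < ln (12 * eps^-1) :> R.
  have /andP[eps_gt0 eps_lt1] := heps.
  apply: ln_gt0; rewrite ltr_pdivlMr // mul1r (lt_le_trans eps_lt1) //.
  by rewrite ler1n.
split=> [|s_gt0 w [w_wt w_min] j|m m_ge].
(* The positive logarithms cancel; [c * s] may be 0, so it is only used as a nonnegative factor. *)
- split=> // w w_wt; rewrite !sampling_boundE !ler_pM2r // max_ratio_uniform //.
  by rewrite ler_wpM2l ?max_ratio_ge1 // mulr_ge0 // ltW.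
(* Comparing [w] with the uniform weights, [0 < s] allows cancelling [c * s], which leaves a maximum
   at most 1. *)
- apply: max_ratio_le1 => //; move: (w_min _ unif_wt).
  by rewrite !sampling_boundE !ler_pM2r // max_ratio_uniform // ler_pM2l //
    mulr_gt0 // ltr0n.
(* For uniform weights the maximum is 1, so the assumption on [m] is exactly the recovery
   condition. *)
- apply: (hrec q s m eps _ x hq heps hx unif_wt).
  by rewrite sampling_boundE max_ratio_uniform // mulr1.
Qed.
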